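(* Let $P$ be a lower-L-bounded or upper-L-bounded poset. Then the limit $\pi(P)=\lim_{n\to\infty}\mathrm{La}(n,P)/\binom{n}{\lfloor n/2\rfloor}$ exists and $\pi(P)=e(P)$.
   Context: All posets are finite and nonempty. Let $[n]=\{1,\dots,n\}$; families of subsets of $[n]$ are ordered by inclusion. A poset $(P,\le)$ contains a poset $(P',\le')$ as a (weak) subposet if there is an injection $f:P'\to P$ such that $u\le' v$ implies $f(u)\le f(v)$. A family $\mathcal F\subseteq 2^{[n]}$ is $P$-free if it does not contain $P$ in this sense. $\mathrm{La}(n,P)$ is the largest size of a $P$-free family $\mathcal F\subseteq 2^{[n]}$. $e(P)$ is the maximum integer $k\ge 0$ such that for all integers $n$ and $s$ the family $\binom{[n]}{s}\cup\binom{[n]}{s+1}\cup\cdots\cup\binom{[n]}{s+k-1}$ is $P$-free, where $\binom{[n]}{j}$ is the collection of $j$-element subsets of $[n]$ (empty if $j<0$ or $j>n$). The Lubell function of $\mathcal F\subseteq 2^{[n]}$ is the average over all $n!$ full (maximal) chains $\mathcal C$ of $2^{[n]}$ of $|\mathcal F\cap\mathcal C|$; equivalently $\bar h_n(\mathcal F)=\sum_{F\in\mathcal F}1/\binom{n}{|F|}$. $P$ is lower-L-bounded if for any $\beta\in(\frac12,1)$ and $\varepsilon>0$ there exists $N=N(\beta,\varepsilon)$ such that for all $n\ge N$, $\bar h_n(\mathcal F)\le e(P)+\varepsilon$ for all $P$-free families $\mathcal F$ of subsets of $[n]$ of sizes less than $\beta n$. $P$ is upper-L-bounded if for any $\alpha\in(0,\frac12)$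 and $\varepsilon>0$ there exists $N=N(\alpha,\varepsilon)$ such that for all $n\ge N$, $\bar h_n(\mathcal F)\le e(P)+\varepsilon$ for all $P$-free families $\mathcal F$ of subsets of $[n]$ of sizes greater than $\alpha n$. *)

(* Defs.v *)
From HB Require Import structures.
From mathcomp Require Import all_boot all_order all_algebra.
From mathcomp Require Import all_classical all_reals all_analysis.
Set Implicit Arguments.
Unset Strict Implicit.
Unset Printing Implicit Defensive.
Import Order.TTheory GRing.Theory Num.Theory.
Import numFieldNormedType.Exports.
Local Open Scope ring_scope.

Section Posets.
Context {d : Order.disp_t}.
Implicit Types (P : finPOrderType d) (n k : nat) (s : int).

(* Weak containment: f need not reflect the order. *)
Definition contains n (F : {set {set 'I_n}}) P : bool :=
  [exists f : {ffun P -> {set 'I_n}},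
    [&& injectiveb f, [forall u, f u \in F]
      & [forall u, forall v, (u <= v)%O ==> (f u \subset f v)]]].

Definition subposet_free n (F : {set {set 'I_n}}) P : bool := ~~ contains F P.

Definition La n P : nat := (\max_(F : {set {set 'I_n}} | subposet_free F P) #|F|)%N.

Definition layer n (j : int) : {set {set 'I_n}} :=
  [set A : {set 'I_n} | #|A|%:Z == j].

Definition layers n s k : {set {set 'I_n}} :=
  (\bigcup_(i < k) layer n (s + i%:Z))%SET.

Definition layers_free P k : Prop := forall n s, subposet_free (layers n s k) P.

Definition is_e P k : Prop :=
  layers_free P k /\ forall k', layers_free P k' -> (k' <= k)%N.

(* By e_posetP below, the default value 0 is irrelevant for nonempty P. *)
Definition e_poset P : nat := xget 0%N [set k | is_e P k]%classic.

End Posets.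

Lemma e_posetP (d : Order.disp_t) (P : finPOrderType d) :
  (0 < #|P|)%N -> is_e P (e_poset P).
Proof.
move=> P0.
suff [k kP] : exists k, is_e P k.
  by rewrite /e_poset; case: xgetP => [y _ //|/(_ k)].
have free0 : layers_free P 0.
  move=> n s; apply/negP => /existsP[f /and3P[_ /forallP fF _]].
  have /card_gt0P[u _] := P0.
  by have := fF u; rewrite /layers big_ord0 inE.
have bnd k : layers_free P k -> (k <= #|P|)%N.
  move=> kfree; rewrite leqNgt; apply/negP => Pk.
  have /negP := kfree #|P| 0; apply; apply/existsP.
  exists [ffun u : P => [set enum_rank v | v : P & (v <= u)%O]].
  apply/and3P; split.
  - apply/injectiveP => u v; rewrite !ffunE => /setP uv.
    have m x y : (enum_rank x \in [set enum_rank z | z : P & (z <= y)%O])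
                 = (x <= y)%O.
      by rewrite mem_imset ?inE //; exact: enum_rank_inj.
    have := uv (enum_rank u); have := uv (enum_rank v).
    by rewrite !m !lexx => vu uv'; apply/le_anti; rewrite vu -uv'.
  - apply/forallP => u; rewrite ffunE; set A := imset _ _.
    have Ak : (#|A| < k)%N.
      by apply: leq_ltn_trans Pk; rewrite -[leqRHS]card_ord max_card.
    by apply/bigcupP; exists (Ordinal Ak) => //; rewrite inE add0r.
  - apply/forallP => u; apply/forallP => v; apply/implyP => uv.
    rewrite !ffunE; apply/imsetS/fintype.subsetP => x; rewrite !inE => xu.
    exact: le_trans xu uv.
have ex : exists k, `[< layers_free P k >] by exists 0%N; exact/asboolP.
have bd k : `[< layers_free P k >] -> (k <= #|P|)%N by move/asboolP/bnd.
have [m /asboolP mf mmax] := ex_maxnP ex bd.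
by exists m; split => // k /asboolP; exact: mmax.
Qed.

Definition is_chain n (C : {set {set 'I_n}}) : bool :=
  [forall A in C, forall B in C, (A \subset B) || (B \subset A)].

Definition full_chains n : {set {set {set 'I_n}}} :=
  [set C | maxset (@is_chain n) C].

Section LBounded.
Context (R : realType).

Definition lubell n (F : {set {set 'I_n}}) : R :=
  (\sum_(C in full_chains n) #|F :&: C|%:R) / #|full_chains n|%:R.

Definition lower_L_bounded d (P : finPOrderType d) : Prop :=
  forall beta eps : R, 1 / 2 < beta < 1 -> 0 < eps ->
  exists N : nat, forall n : nat, (N <= n)%N ->
  forall F : {set {set 'I_n}}, subposet_free F P ->
    (forall A, A \in F -> #|A|%:R < beta * n%:R) ->
    lubell F <= (e_poset P)%:R + eps.

Definition upper_L_bounded d (P : finPOrderType d) : Prop :=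
  forall alpha eps : R, 0 < alpha < 1 / 2 -> 0 < eps ->
  exists N : nat, forall n : nat, (N <= n)%N ->
  forall F : {set {set 'I_n}}, subposet_free F P ->
    (forall A, A \in F -> alpha * n%:R < #|A|%:R) ->
    lubell F <= (e_poset P)%:R + eps.

Definition La_ratio d (P : finPOrderType d) : nat -> R :=
  fun n => (La n P)%:R / 'C(n, n./2)%:R.

Definition La_limit d (P : finPOrderType d) : R := limn (La_ratio P).

End LBounded.

(* Main.v *)
(* Upper bound: permutations of [n] preserve full chains, so all sets of a given
   size lie on equally many of them; hence A lies on at least a
   1 / 'C(n, n/2) fraction of the full chains, and |F| / 'C(n, n/2) is at most
   the Lubell function of F.  L-boundedness controls the Lubell function of a
   P-free family once the sets of size >= 3n/4 (resp. <= n/4) are discarded, and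
   by a Chernoff estimate there are only o('C(n, n/2)) of those.
   Lower bound: e(P) consecutive layers starting at n/2 form a P-free family, and
   each has size asymptotic to 'C(n, n/2). *)
Require Import Defs.
From HB Require Import structures.
From mathcomp Require Import all_boot all_order all_fingroup all_algebra.
From mathcomp Require Import all_classical all_reals all_analysis.
From mathcomp Require Import zify lra.
(* Imported again to take precedence over the homonyms of classical_sets. *)
From mathcomp Require Import fintype finset.
Import Order.TTheory GRing.Theory Num.Theory.
Import numFieldNormedType.Exports.

(** * Binomial coefficients and the number of large sets *)

Lemma bin_le_half n k : ('C(n, k) <= 'C(n, n./2))%N.
Proof.
have low m : (m <= n./2)%N -> ('C(n, m) <= 'C(n, n./2))%N.
  (* Induction on the distance below the middle: each step away from it does not increase the
     coefficient. *)
  move=> mn; rewrite -(subKn mn); elim: (n./2 - m)%N => [|i IH].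
    by rewrite subn0.
  have [ni|ni] := leqP (n./2) i; first by rewrite (_ : n./2 - i.+1 = n./2 - i)%N//; lia.
  apply: leq_trans IH; have := mul_bin_left n (n./2 - i.+1).
  rewrite (_ : (n./2 - i.+1).+1 = n./2 - i)%N; last by lia.
  move=> E; rewrite -(@leq_pmul2l (n./2 - i)) ?subn_gt0// E.
  by rewrite leq_mul2r; apply/orP; right; lia.
have [kn|nk] := leqP k (n./2); first exact: low.
have [kn|nk'] := leqP k n; last by rewrite bin_small.
by rewrite -bin_sub//; apply: low; lia.
Qed.

Lemma expn2_le_bin_half n : (2 ^ n <= n.+1 * 'C(n, n./2))%N.
Proof.
rewrite -[2%N]/(1 + 1)%N expnDn -[n.+1 in leqRHS]card_ord -sum_nat_const.
by apply: leq_sum => i _; rewrite !exp1n !muln1 bin_le_half.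
Qed.

(** Expand the product of [x + 1] over [T]: choosing [x] exactly at the elements of [A] gives the
    term of [A]. *)
Lemma sum_expn_card (T : finType) (x : nat) :
  (\sum_(A : {set T}) x ^ #|A| = x.+1 ^ #|T|)%N.
Proof.
rewrite -[x.+1]addn1 -prod_nat_const bigA_distr; apply: eq_bigr => A _.
by rewrite -big_mkcond prod_nat_const.
Qed.

(* Chernoff: each large set contributes at least [2 ^ (3 n / 4)] to
   [\sum_A 2 ^ #|A| = 3 ^ n], and [3 / 2 ^ (3 / 4) < 9 / 5]. *)
Lemma card_large_sets n :
  (5 ^ n * #|[set A : {set 'I_n} | 3 * n <= 4 * #|A|]| <= 9 ^ n)%N.
Proof.
set T := #|_|; pose m := ((3 * n + 3) %/ 4)%N.
have Tm : (T * 2 ^ m <= 3 ^ n)%N.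
  rewrite -[n in leqRHS]card_ord -sum_expn_card -sum_nat_const.
  apply: (@leq_trans (\sum_(A in [set A : {set 'I_n} | 3 * n <= 4 * #|A|]) 2 ^ #|A|)%N).
    apply: leq_sum => A; rewrite inE => hA; rewrite leq_exp2l// /m; lia.
  by rewrite [leqRHS](bigID (mem [set A : {set 'I_n} | 3 * n <= 4 * #|A|]))/= leq_addr.
have m3 : (3 * n <= 4 * m)%N by rewrite /m; lia.
(* Fourth powers clear the exponent 3/4: [8 ^ n = 2 ^ (3 n) <= 2 ^ (4 m)], which leaves the
   numerical fact [5 ^ 4 * 81 <= 8 * 9 ^ 4]. *)
clearbody T m; rewrite -(@leq_exp2r _ _ 4)// -(@leq_pmul2l (8 ^ n)) ?expn_gt0//.
have T8 : (8 ^ n * T ^ 4 <= 81 ^ n)%N.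
  apply: (@leq_trans ((T * 2 ^ m) ^ 4)%N).
    rewrite expnMn mulnC leq_mul2l -expnM -[8%N]/(2 ^ 3)%N -expnM leq_exp2l//.
    by rewrite (mulnC m) m3 orbT.
  by rewrite -[81%N]/(3 ^ 4)%N -expnM (mulnC 4) expnM leq_exp2r.
rewrite expnMn -!expnM !(mulnC n 4) !expnM mulnCA.
apply: (@leq_trans ((5 ^ 4) ^ n * 81 ^ n)%N); first by rewrite leq_mul2l T8 orbT.
have base : (5 ^ 4 * 81 <= 8 * 9 ^ 4)%N by lia.
by rewrite -!expnMn; case: (n) => [|i]; rewrite ?expn0 ?leq_exp2r.
Qed.

(** * Full chains meet every layer *)

Lemma exists_perm_imset (T : finType) (A B : {set T}) :
  #|A| = #|B| -> exists s : {perm T}, s @: A = B.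
Proof.
(* [e X] lists [X] first and then its complement; matching [e A] with [e B] position by position
   sends [A] onto [B]. *)
move=> AB; pose e (X : {set T}) := enum X ++ enum (~: X).
have e_uniq X : uniq (e X).
  rewrite cat_uniq !enum_uniq andbT /=; apply/hasPn => x.
  by rewrite !mem_enum inE.
have e_mem X x : x \in e X by rewrite mem_cat !mem_enum inE orbN.
have e_size X : size (e X) = #|T| by rewrite size_cat -!cardE cardsC.
pose f x := nth x (e B) (index x (e A)).
have idx X x : (index x (e X) < #|T|)%N by rewrite -(e_size X) index_mem.
have f_inj : injective f.
  move=> x y; rewrite /f (set_nth_default x y) ?e_size// => /eqP.
  by rewrite nth_uniq ?e_size// => /eqP/index_inj; apply.
exists (perm f_inj); apply/eqP; rewrite eqEcard card_imset ?AB; last exact: perm_inj.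
rewrite leqnn andbT; apply/subsetP => _ /imsetP[x xA ->]; rewrite permE /f.
have lt : (index x (e A) < #|B|)%N.
  by rewrite index_cat mem_enum xA -AB [X in (_ < X)%N]cardE index_mem mem_enum.
by rewrite nth_cat -cardE lt -mem_enum mem_nth// -cardE.
Qed.

Lemma exists_set_between (T : finType) (A B : {set T}) k :
  A \subset B -> (#|A| <= k <= #|B|)%N ->
  exists D : {set T}, [/\ A \subset D, D \subset B & #|D| = k].
Proof.
move=> AB /andP[]; elim: k => [|k IH].
  by rewrite leqn0 => /eqP A0 _; exists A.
rewrite leq_eqVlt => /orP[/eqP Ak _|Ak kB]; first by exists A.
have [D [AD DB Dk]] := IH Ak (ltnW kB).
have /properP[_ [x xB xD]] : D \proper B by rewrite properEcard DB Dk.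
exists (x |: D); rewrite cardsU1 xD Dk.
by rewrite (subset_trans AD) ?subsetUr// subUset sub1set xB.
Qed.

Lemma is_chainP n (C : {set {set 'I_n}}) :
  reflect {in C &, forall A B : {set 'I_n}, (A \subset B) || (B \subset A)}
    (is_chain C).
Proof.
apply: (iffP idP) => [/forall_inP h A B AC BC|h].
  by have /forall_inP := h A AC; apply.
by apply/forall_inP => A AC; apply/forall_inP => B BC; apply: h.
Qed.

(** Within a chain the selected sets, if any, have a largest member, and it contains their union. *)
Lemma card_bigcup_chain n (C : {set {set 'I_n}}) (Q : pred {set 'I_n}) k :
  is_chain C -> (forall A, A \in C -> Q A -> #|A| <= k)%N ->
  (#|\bigcup_(A in C | Q A) A| <= k)%N.
Proof.
move=> /is_chainP chC small; case: (pickP [pred A in C | Q A]) => [A0 A0C|no].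
  case: (@arg_maxnP _ A0 [pred A in C | Q A] (fun A => #|A|) A0C).
  move=> M /andP[MC QM] Mmax.
  apply: leq_trans (small M MC QM); apply/subset_leq_card/bigcupsP => A /andP[AC QA].
  have /orP[//|MA] := chC _ _ AC MC.
  have /eqP -> // : M == A; by rewrite eqEcard MA; apply: Mmax; rewrite /= AC.
by rewrite big_pred0// cards0.
Qed.

Lemma is_chain_setC n (C : {set {set 'I_n}}) :
  is_chain C -> is_chain [set ~: A | A in C].
Proof.
move=> /is_chainP chC; apply/is_chainP => _ _ /imsetP[A AC ->] /imsetP[B BC ->].
by rewrite !setCS orbC chC.
Qed.

(** Any [k]-set squeezed between the union [L] of the members of size at most [k] and the
    intersection [U] of the larger ones is comparable to every member, so maximality puts it in
    [C]. *)
Lemma full_chain_meets_layers n (C : {set {set 'I_n}}) k :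
  C \in full_chains n -> (k <= n)%N -> exists2 A, A \in C & #|A| = k.
Proof.
rewrite inE => /maxsetP[chC maxC] kn; have /is_chainP chP := chC.
pose L := \bigcup_(A in C | (#|A| <= k)%N) A.
pose U := \bigcap_(A in C | (k < #|A|)%N) A.
have LU : L \subset U.
  apply/bigcupsP => A /andP[AC Ak]; apply/bigcapsP => B /andP[BC Bk].
  have /orP[//|BA] := chP _ _ AC BC.
  by have := subset_leq_card BA; rewrite leqNgt (leq_ltn_trans Ak Bk).
have Lk : (#|L| <= k)%N by apply: card_bigcup_chain => // A _.
(* Dual of [Lk], obtained by complementing the chain. *)
have kU : (k <= #|U|)%N.
  have CU : ~: U = \bigcup_(A in [set ~: A | A in C] | (k < #|~: A|)%N) A.
    rewrite /U setC_bigcap; apply/setP => x; apply/bigcupP/bigcupP => -[A].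
      by move=> /andP[AC Ak] xA; exists (~: A); rewrite ?setCK ?imset_f.
    by case/andP=> /imsetP[B BC ->]; rewrite setCK => Bk xB; exists B; rewrite ?BC.
  have := @card_bigcup_chain n [set ~: A | A in C] (fun A => k < #|~: A|)%N (n - k).
  rewrite -CU cardsCs setCK card_ord => /(_ (is_chain_setC _ _ chC)) H.
  suff : (n - #|U| <= n - k)%N by move: (max_card (mem U)); rewrite card_ord; lia.
  by apply: H => A _; have := cardsC A; rewrite card_ord; lia.
have [D [LD DU Dk]] := exists_set_between _ _ _ _ LU (introT andP (conj Lk kU)).
exists D => //; rewrite -(maxC (D |: C)) ?setU11 ?subsetUr//.
have cmp A : A \in C -> (A \subset D) || (D \subset A).
  move=> AC; have [Ak|Ak] := leqP #|A| k.
    by rewrite (subset_trans _ LD)//; apply: bigcup_sup; rewrite AC.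
  by rewrite (subset_trans DU) ?orbT//; apply: bigcap_inf; rewrite AC.
apply/is_chainP => A B; rewrite !inE => /predU1P[->|AC] /predU1P[->|BC].
- by rewrite subxx.
- by rewrite orbC cmp.
- exact: cmp.
- exact: chP.
Qed.

Lemma full_chains_gt0 n : (0 < #|full_chains n|)%N.
Proof.
have /maxset_exists[C mC _] : is_chain (set0 : {set {set 'I_n}}).
  by apply/is_chainP => A B; rewrite inE.
by apply/card_gt0P; exists C; rewrite inE.
Qed.

(** * Permutations acting on full chains *)

Definition chains_through {n} (A : {set 'I_n}) : {set {set {set 'I_n}}} :=
  [set C in full_chains n | A \in C].

Definition perm_family {n} (s : {perm 'I_n}) (C : {set {set 'I_n}}) :
  {set {set 'I_n}} := [set s @: A | A : {set 'I_n} in C].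

Lemma is_chain_perm_family n (s : {perm 'I_n}) (C : {set {set 'I_n}}) :
  is_chain C -> is_chain (perm_family s C).
Proof.
move=> /is_chainP chC; apply/is_chainP => _ _ /imsetP[A AC ->] /imsetP[B BC ->].
by have /orP[] := chC _ _ AC BC => /(imsetS s) ->; rewrite ?orbT.
Qed.

Lemma perm_familyK n (s : {perm 'I_n}) :
  cancel (perm_family s) (perm_family s^-1%g).
Proof.
move=> C; rewrite /perm_family -imset_comp -[RHS]imset_id; apply: eq_imset => A /=.
by rewrite -imset_comp -[RHS]imset_id; apply: eq_imset => x /=; rewrite permK.
Qed.

Lemma full_chains_perm_family n (s : {perm 'I_n}) (C : {set {set 'I_n}}) :
  C \in full_chains n -> perm_family s C \in full_chains n.
Proof.
rewrite !inE => /maxsetP[chC maxC]; apply/maxsetP.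
split=> [|D chD CD]; first exact: is_chain_perm_family.
(* Pulled back along [s], [D] is a chain containing [C], hence equal to [C]. *)
have := perm_familyK _ s^-1%g D; rewrite invgK => <-.
rewrite (maxC (perm_family s^-1%g D))//; first exact: is_chain_perm_family.
by rewrite -{1}(perm_familyK _ s C); apply: imsetS.
Qed.

Lemma card_chains_through n (A B : {set 'I_n}) :
  #|A| = #|B| -> #|chains_through A| <= #|chains_through B|.
Proof.
move=> /exists_perm_imset[s <-].
rewrite -(card_imset _ (can_inj (perm_familyK _ s))).
apply/subset_leq_card/subsetP => _ /imsetP[C + ->].
by case/setIdP=> Cf AC; apply/setIdP; rewrite full_chains_perm_family// imset_f.
Qed.

(** Every full chain passes through some set of size [#|A|]; there are ['C(n, #|A|)] such sets, and
    each lies on no more full chains than [A]. *)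
Lemma card_full_chains_le n (A : {set 'I_n}) :
  (#|full_chains n| <= 'C(n, n./2) * #|chains_through A|)%N.
Proof.
apply: (@leq_trans ('C(n, #|A|) * #|chains_through A|)%N); last first.
  by rewrite leq_mul2r bin_le_half orbT.
rewrite -[n in 'C(n, _)]card_ord -card_draws -sum_nat_const.
pose S := [set B : {set 'I_n} | #|B| == #|A|].
apply: (@leq_trans (\sum_(B in S) #|chains_through B|)%N).
  apply: (@leq_trans #|\bigcup_(B in S) chains_through B|).
    apply/subset_leq_card/subsetP => C Cf.
    have [|B BC BA] := @full_chain_meets_layers n C #|A| Cf.
      by rewrite -[leqRHS]card_ord max_card.
    by apply/bigcupP; exists B; [rewrite inE BA|apply/setIdP].
  exact: unstable.card_big_setU.
by apply: leq_sum => B; rewrite inE => /eqP; apply: card_chains_through.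
Qed.

(** * The Lubell function and bounds on [La] for fixed [n] *)

Local Open Scope ring_scope.

Lemma card_le_lubell (R : realType) n (F : {set {set 'I_n}}) :
  #|F|%:R / 'C(n, n./2)%:R <= lubell R F.
Proof.
have C0 : (0 < 'C(n, n./2))%N by rewrite bin_gt0; lia.
rewrite /lubell ler_pdivrMr ?ltr0n// mulrAC ler_pdivlMr ?ltr0n ?full_chains_gt0//.
rewrite -natr_sum -!natrM ler_nat.
(* Double counting of the pairs formed by a full chain and a member of [F] on it. *)
have -> : (\sum_(C in full_chains n) #|F :&: C| = \sum_(A in F) #|chains_through A|)%N.
  under eq_bigr do
    rewrite -sum1_card (eq_bigl _ _ (fun x => in_setI _ _ _)) big_mkcondr/=.
  rewrite exchange_big/=; apply: eq_bigr => A AF.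
  by rewrite -big_mkcondr sum1dep_card.
rewrite big_distrl /= -sum_nat_const; apply: leq_sum => A _.
by rewrite mulnC card_full_chains_le.
Qed.

Lemma card_layers n (m k : nat) :
  #|layers n m%:Z k| = (\sum_(i < k) 'C(n, m + i))%N.
Proof.
rewrite -sum1_card partition_disjoint_bigcup; last first.
  move=> i j ij; rewrite disjoints_subset; apply/subsetP => A.
  rewrite !inE => /eqP ->; apply: contraNN ij => /eqP ?; apply/eqP/val_inj => /=; lia.
apply: eq_bigr => i _; rewrite sum1_card -[n in RHS]card_ord -card_draws.
by apply: eq_card => A; rewrite !inE -PoszD.
Qed.

Lemma La_ge (d : Order.disp_t) (P : finPOrderType d) n (m k : nat) :
  layers_free P k -> (\sum_(i < k) 'C(n, m + i) <= La n P)%N.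
Proof. by move=> free; rewrite -card_layers; apply: leq_bigmax_cond; apply: free. Qed.

Lemma subposet_freeS (d : Order.disp_t) (P : finPOrderType d) n
    (F G : {set {set 'I_n}}) :
  F \subset G -> subposet_free G P -> subposet_free F P.
Proof.
move=> /subsetP FG; apply: contraNN => /existsP[f /and3P[fi /forallP fF fm]].
by apply/existsP; exists f; rewrite fi fm andbT /=; apply/forallP => u; apply: FG.
Qed.

(** Split a [P]-free family by [Q]: the part inside is again [P]-free and is bounded through its
    Lubell function, the part outside by counting all sets that violate [Q]. *)
Lemma La_ratio_le (R : realType) (d : Order.disp_t) (P : finPOrderType d) n
    (Q : pred {set 'I_n}) (c : R) :
  (0 < #|P|)%N ->
  (forall F : {set {set 'I_n}}, subposet_free F P -> {in F, forall A, Q A} ->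
     lubell R F <= c) ->
  La_ratio R P n <= c + #|[set A : {set 'I_n} | ~~ Q A]|%:R / 'C(n, n./2)%:R.
Proof.
move=> P0 hc; have C0 : (0 < 'C(n, n./2))%N by rewrite bin_gt0; lia.
have bound (F : {set {set 'I_n}}) : subposet_free F P ->
    #|F|%:R / 'C(n, n./2)%:R <=
    c + #|[set A : {set 'I_n} | ~~ Q A]|%:R / 'C(n, n./2)%:R.
  move=> freeF; rewrite -(cardsID [set A | Q A] F) natrD mulrDl lerD//.
    apply: le_trans (card_le_lubell _ _ _) (hc _ _ _).
      exact: subposet_freeS (subsetIl _ _) freeF.
    by move=> A; rewrite !inE => /andP[].
  rewrite ler_pM2r ?invr_gt0 ?ltr0n// ler_nat; apply/subset_leq_card/subsetP => A.
  by rewrite !inE => /andP[].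
(* Some family is [P]-free, so the maximum defining [La] is attained. *)
have free0 : subposet_free (set0 : {set {set 'I_n}}) P.
  have /card_gt0P[u _] := P0; apply/negP => /existsP[f /and3P[_ /forallP/(_ u)]].
  by rewrite inE.
rewrite /La_ratio /La.
have [|F freeF ->] := @eq_bigmax_cond _ (fun F => subposet_free F P)
  (fun F : {set {set 'I_n}} => #|F|).
  by apply/card_gt0P; exists set0.
exact: bound.
Qed.

(* The polynomial factor of [expn2_le_bin_half] is absorbed by Bernoulli's
   inequality [n + 1 <= 19 (20 / 19) ^ n]. *)
Lemma tail_le (R : realType) n T :
  (5 ^ n * T <= 9 ^ n)%N ->
  T%:R / 'C(n, n./2)%:R <= geometric 19 (18 / 19) n :> R.
Proof.
move=> T5; have C0 : (0 < 'C(n, n./2))%N by rewrite bin_gt0; lia.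
have bern : (n.+1 * 19 ^ n <= 19 * 20 ^ n)%N.
  (* This is [(1 + 1/19) ^ n >= 1 + n/19] with denominators cleared. *)
  have : ((19 + n) * 19 ^ n <= 19 * 20 ^ n)%N.
    by elim: n {T5 C0} => // n IH; rewrite !expnS; nia.
  by apply: leq_trans; rewrite leq_mul2r; apply/orP; right; lia.
have key : (T * 19 ^ n <= 19 * 18 ^ n * 'C(n, n./2))%N.
  have E10 : (10 ^ n = 5 ^ n * 2 ^ n)%N by rewrite -expnMn.
  have E180 : (18 ^ n * 10 ^ n = 9 ^ n * 20 ^ n)%N by rewrite -!expnMn.
  (* The rates multiply to [(9/5) * (1/2) * (20/19) = 18/19]. *)
  have H := leq_mul (leq_mul T5 (expn2_le_bin_half n)) bern.
  rewrite -(@leq_pmul2r (10 ^ n * n.+1)) ?muln_gt0 ?expn_gt0//.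
  have -> : (19 * 18 ^ n * 'C(n, n./2) * (10 ^ n * n.+1) =
             9 ^ n * (n.+1 * 'C(n, n./2)) * (19 * 20 ^ n))%N.
    rewrite (_ : 9 ^ n * _ * _ =
                 9 ^ n * 20 ^ n * (19 * n.+1 * 'C(n, n./2)))%N; last first.
      by move: (9 ^ n)%N (20 ^ n)%N => x y; lia.
    by rewrite -E180; move: (18 ^ n)%N (10 ^ n)%N => x y; lia.
  apply: leq_trans H; rewrite E10.
  by move: (5 ^ n)%N (2 ^ n)%N (19 ^ n)%N => x y z; lia.
rewrite /geometric /= exprMn exprVn mulrA ler_pdivrMr ?ltr0n// mulrAC.
by rewrite ler_pdivlMr ?exprn_gt0 ?ltr0n// -!natrX -!natrM ler_nat.
Qed.

Lemma card_small_sets n :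
  (5 ^ n * #|[set A : {set 'I_n} | 4 * #|A| <= n]| <= 9 ^ n)%N.
Proof.
apply: leq_trans (card_large_sets n); rewrite leq_mul2l; apply/orP; right.
rewrite -(card_imset _ (inv_inj (@setCK _))).
apply/subset_leq_card/subsetP => _ /imsetP[A + ->].
by rewrite !inE; have := cardsC A; rewrite card_ord; lia.
Qed.

(** * Asymptotics *)

Local Open Scope classical_set_scope.
Local Open Scope ring_scope.

Lemma La_ratio_le_geometric (R : realType) (d : Order.disp_t)
    (P : finPOrderType d) (eps : R) :
  (0 < #|P|)%N -> lower_L_bounded R P \/ upper_L_bounded R P -> 0 < eps ->
  \forall n \near \oo,
    La_ratio R P n <= (e_poset P)%:R + eps + geometric 19 (18 / 19) n.
Proof.
move=> P0 [] LB eps0.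
  (* The cutoff 3/4 matches [card_large_sets]; the upper case below uses its mirror image 1/4. *)
  have [|N hN] := LB (3 / 4) eps _ eps0; first by apply/andP; split; lra.
  exists N => // n /= Nn.
  apply: le_trans (@La_ratio_le R d P n (fun A => (4 * #|A| < 3 * n)%N) _ P0 _) _.
    move=> F freeF FQ; apply: (hN n Nn F freeF) => A /FQ.
    by rewrite -(ltr_nat R) !natrM; lra.
  rewrite lerD2l; apply: tail_le; apply: leq_trans (card_large_sets n).
  rewrite leq_mul2l; apply/orP; right; apply/subset_leq_card/subsetP => A.
  by rewrite !inE -leqNgt.
have [|N hN] := LB (1 / 4) eps _ eps0; first by apply/andP; split; lra.
exists N => // n /= Nn.
apply: le_trans (@La_ratio_le R d P n (fun A => (n < 4 * #|A|)%N) _ P0 _) _.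
  move=> F freeF FQ; apply: (hN n Nn F freeF) => A /FQ.
  by rewrite -(ltr_nat R) !natrM; lra.
rewrite lerD2l; apply: tail_le; apply: leq_trans (card_small_sets n).
rewrite leq_mul2l; apply/orP; right; apply/subset_leq_card/subsetP => A.
by rewrite !inE -leqNgt.
Qed.

(** By induction on [i]: the quotient [q] of consecutive coefficients at a fixed offset from the
    middle tends to 1. *)
Lemma bin_ratio_cvg (R : realType) i :
  'C(n, n./2 + i)%:R / 'C(n, n./2)%:R @[n --> \oo] --> (1 : R).
Proof.
elim: i => [|i IH].
  apply: cvg_near_cst; apply: nearW => n /=.
  by rewrite addn0 divff// pnatr_eq0 -lt0n bin_gt0; lia.
pose q n : R := (n - (n./2 + i))%:R / (n./2 + i).+1%:R.
have q1 : q n @[n --> \oo] --> (1 : R).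
  (* With [j = n./2 + i], [1 - q n] is at most [(2 j + 1 - n) / (j + 1)], where
     [2 j + 1 - n <= 2 i + 1] and [j + 1 >= (n + 1) / 2]; hence the constant [4 i + 2]. *)
  apply: (@squeeze_cvgr _ _ _ _ (fun n => 1 - (4 * i + 2)%:R * harmonic n) (cst 1)).
  - apply: nearW => n /=; rewrite /q.
    have b0 : 0 < (n./2 + i).+1%:R :> R by rewrite ltr0n.
    have n0 : 0 < n.+1%:R :> R by rewrite ltr0n.
    apply/andP; split; last by rewrite ler_pdivrMr// mul1r ler_nat; lia.
    rewrite ler_pdivlMr// -(ler_pM2r n0).
    have -> : (1 - (4 * i + 2)%:R / n.+1%:R) * (n./2 + i).+1%:R * n.+1%:R =
              (n./2 + i).+1%:R * n.+1%:R - (4 * i + 2)%:R * (n./2 + i).+1%:R :> R.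
      by rewrite mulrAC mulrBl mul1r mulrVK ?unitfE ?gt_eqF// mulrBl mulrC.
    rewrite lerBlDr -!natrM -natrD ler_nat; nia.
  - rewrite -[X in _ --> X]subr0; apply: cvgB; first exact: cvg_cst.
    by rewrite -[X in _ --> X](mulr0 (4 * i + 2)%:R); apply: cvgMr; exact: cvg_harmonic.
  - exact: cvg_cst.
rewrite -[X in _ --> X]mulr1; apply: cvg_trans (cvgM IH q1); apply: near_eq_cvg.
have rec n : 'C(n, n./2 + i.+1)%:R = 'C(n, n./2 + i)%:R * q n :> R.
  apply: (mulIf (_ : (n./2 + i).+1%:R != 0)); first by rewrite pnatr_eq0.
  rewrite /q mulrA mulrVK ?unitfE ?pnatr_eq0// -!natrM addnS.
  by rewrite mulnC mul_bin_left mulnC.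
by apply: nearW => n /=; rewrite rec mulrAC.
Qed.

Lemma sum_bin_ratio_cvg (R : realType) k :
  (\sum_(i < k) 'C(n, n./2 + i))%:R / 'C(n, n./2)%:R @[n --> \oo] --> (k%:R : R).
Proof.
elim: k => [|k IH].
  by apply: cvg_near_cst; apply: nearW => n; rewrite big_ord0 mul0r.
rewrite -natr1; apply: cvg_trans (cvgD IH (bin_ratio_cvg R k)); apply: near_eq_cvg.
by apply: nearW => n /=; rewrite big_ord_recr /= natrD mulrDl.
Qed.

Theorem proposition3p5 (R : realType) (d : Order.disp_t)
    (P : finPOrderType d) (P_nonempty : (0 < #|P|)%N)
    (P_L_bounded : lower_L_bounded R P \/ upper_L_bounded R P) :
  cvgn (La_ratio R P) /\ La_limit R P = (e_poset P)%:R.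
Proof.
have [free _] := e_posetP P_nonempty.
suff lim : La_ratio R P n @[n --> \oo] --> ((e_poset P)%:R : R).
  by split; [exact: cvgP lim|exact: cvg_lim lim].
(* From above, one half of [eps] pays for L-boundedness and the other for the geometric tail; from
   below, the layers alone may use all of [eps]. *)
apply/cvgrPdist_le => eps eps0; have eps2 : 0 < eps / 2 by rewrite divr_gt0.
have /cvgrPdist_le/(_ _ eps0) low := sum_bin_ratio_cvg R (e_poset P).
have up := La_ratio_le_geometric R d P (eps / 2) P_nonempty P_L_bounded eps2.
have /cvgrPdist_le/(_ _ eps2) geo : geometric 19 (18 / 19) n @[n --> \oo] --> (0 : R).
  by apply: cvg_geometric; rewrite ger0_norm ?divr_ge0//; lra.
apply: filterS3 low up geo => n; rewrite !ler_norml => /andP[_ l] u /andP[g _].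
have L : (\sum_(i < e_poset P) 'C(n, n./2 + i))%:R / 'C(n, n./2)%:R <= La_ratio R P n.
  by rewrite ler_wpM2r ?invr_ge0 ?ler0n// ler_nat La_ge.
by apply/andP; split; lra.
Qed.
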